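(* Let $\{x^k\}_{k\ge 0}$ be generated by the proximal point iteration $x^{k+1}=\arg\min\{q(x)+\frac{\gamma}{2}\|x-x^k\|^2 : x\in\Omega\}$. Assume $\bar x$ is the limit point of this iteration (i.e. $x^k\to\bar x$) and that the strict complementarity conditions hold at $\bar x$. Then there exists $N>0$ such that the following hold for all $k\ge N$: (i) $\|x^{k+1}-x^{k+2}\|\le\bar\rho\,\|x^k-x^{k+1}\|$ and $\|x^{k+1}-\bar x\|\le\bar\rho\,\|x^k-\bar x\|$; (ii) $q(x^k)-q(\bar x)\le\dfrac{\|Q_{\bar{\mathcal A}_m\bar{\mathcal A}_m}\|\,\bar\rho^{\,2(k-N)}}{2(1-\bar\rho)^2}\,\|x^N-x^{N+1}\|^2$, where $$\bar\rho=\max_{\lambda_i(\bar M)<1}\lambda_i(\bar M)=\frac{\gamma}{\gamma+\min_{\bar\lambda_i>0}\bar\lambda_i}\in(0,1),$$ $\bar{\mathcal A}_m=\mathcal A_m(\bar x)$, $\bar\lambda_i$ are the eigenvalues of $Q_{\bar{\mathcal A}_m\bar{\mathcal A}_m}$, and $\lambda_i(\bar M)$ are the eigenvalues of $\bar M=\gamma\,(Q_{\bar{\mathcal A}_m\bar{\mathcal A}_m}+\gamma I)^{-1}$.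
   Context: Let $q(x)=\frac12x^TQx+r^Tx$ with $Q\in\mathbb R^{n\times n}$ symmetric and not positive definite (possibly indefinite), $r,l,u\in\mathbb R^n$, and $\Omega=\{x\in\mathbb R^n: l\le x\le u\}$ (componentwise), the feasible set; assume $\inf_{x\in\Omega}q(x)>-\infty$. Fix a constant $\delta>0$ and put $\gamma=\delta-\lambda_{\min}(Q)$, where $\lambda_{\min}(Q)$ is the smallest eigenvalue of $Q$, so that each proximal subproblem is strictly convex. $\|\cdot\|$ is the Euclidean norm of vectors and the induced (spectral) norm of matrices. For $x\in\Omega$ define $\mathcal A_l(x)=\{j: x_j=l_j\}$, $\mathcal A_m(x)=\{j: l_j<x_j<u_j\}$, $\mathcal A_u(x)=\{j: x_j=u_j\}$. For an index set $\mathcal A$, $Q_{\mathcal A\mathcal A}$ is the submatrix of $Q$ with rows and columns in $\mathcal A$. A KKT point $\bar x\in\Omega$ of $\min_{x\in\Omega}q(x)$ satisfies $\frac{\partial q}{\partial x_j}(\bar x)\ge0$ for $j\in\mathcal A_l(\bar x)$, $=0$ for $j\in\mathcal A_m(\bar x)$, $\le0$ for $j\in\mathcal A_u(\bar x)$; the strict complementarity conditions hold at $\bar x$ if moreover $\frac{\partial q}{\partial x_j}(\bar x)>0$ for $j\in\mathcal A_l(\bar x)$ and $\frac{\partial q}{\partial x_j}(\bar x)<0$ for $j\in\mathcal A_u(\bar x)$. *)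

(* Defs.v *)
From HB Require Import structures.
From mathcomp Require Import all_boot all_order all_algebra.
From mathcomp Require Import all_classical all_reals all_analysis.
Set Implicit Arguments.
Unset Strict Implicit.
Unset Printing Implicit Defensive.
Import Order.TTheory GRing.Theory Num.Theory.
Import numFieldNormedType.Exports.
Local Open Scope classical_set_scope.
Local Open Scope ring_scope.

Section Spectrum.
Context {R : realType}.

(* The default value 0 is only returned for a set that has no least (greatest)
   element.  The sets considered here are finite, so this happens only for the
   empty set. *)
Definition setmin (A : set R) : R := xget 0 (A `&` lbound A).
Definition setmax (A : set R) : R := xget 0 (A `&` ubound A).

(* [eigenvalue] ranges over the base field, here R; this is the whole spectrum
   of the matrices it is applied to, which are all symmetric. *)
Definition lambda_min {n} (A : 'M[R]_n) : R := setmin [set a | eigenvalue A a].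

(* The norm that the library puts on matrices and vectors is the maximum norm,
   hence the next two definitions. *)
Definition norm2 {n} (x : 'cV[R]_n) : R := Num.sqrt (\sum_(i < n) x i 0 ^+ 2).

Definition opnorm2 {m n} (A : 'M[R]_(m, n)) : R :=
  sup [set norm2 (A *m x) | x in [set x : 'cV[R]_n | norm2 x <= 1]].

Definition posdefmx {n} (A : 'M[R]_n) : Prop :=
  forall x : 'cV[R]_n, x != 0 -> 0 < (x^T *m A *m x) 0 0.

Definition principal_submx {n} (I : {set 'I_n}) (A : 'M[R]_n) : 'M[R]_#|I| :=
  mxsub (fun i : 'I_#|I| => enum_val i) (fun j : 'I_#|I| => enum_val j) A.

End Spectrum.

Definition argmin {R : realType} {T : Type} (A : set T) (f : T -> R) : set T :=
  [set x | A x /\ forall y, A y -> f x <= f y].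

Section BoxQP.
Context {R : realType} {n : nat}.
Implicit Types (Q : 'M[R]_n) (r l u x : 'cV[R]_n) (q : 'cV[R]_n -> R).

Definition quad Q r x : R := 2^-1 * (x^T *m Q *m x) 0 0 + (r^T *m x) 0 0.

Definition box l u : set 'cV[R]_n :=
  [set x | forall j, l j 0 <= x j 0 <= u j 0].

Definition act_l l x : {set 'I_n} := [set j | x j 0 == l j 0]%SET.
Definition act_m l u x : {set 'I_n} := [set j | l j 0 < x j 0 < u j 0]%SET.
Definition act_u u x : {set 'I_n} := [set j | x j 0 == u j 0]%SET.

Definition partial q (j : 'I_n) x : R := 'D_(delta_mx j 0 : 'cV[R]_n) q x.

Definition kkt_point l u q x : Prop :=
  [/\ box l u x,
      forall j, j \in act_l l x -> 0 <= partial q j x,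
      forall j, j \in act_m l u x -> partial q j x = 0
    & forall j, j \in act_u u x -> partial q j x <= 0].

Definition strict_complementarity l u q x : Prop :=
  [/\ kkt_point l u q x,
      forall j, j \in act_l l x -> 0 < partial q j x
    & forall j, j \in act_u u x -> partial q j x < 0].

End BoxQP.

(* Main.v *)
(* Strict complementarity and first-order optimality of the proximal step pin
   the active coordinates of [x k] to those of [xbar] after finitely many steps.
   From then on the free coordinates [d k] of [x k - xbar] obey the linear
   recursion [(Qmm + gamma) d_(k+1) = gamma d_k].  Along an eigenvector of [Qmm]
   with eigenvalue [<= 0] the component of [d k] does not decrease in absolute
   value, and it tends to 0, so it vanishes: all [d k] lie in the orthogonal of
   these eigenvectors, on which the Rayleigh quotient of [Qmm] is bounded below
   by the least positive eigenvalue.  This yields the rate [rho] both for [d k]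
   and for its increments, and [q (x k) - q xbar] is the quadratic form
   [(Qmm d_k, d_k) / 2]. *)
Require Import Defs.
From HB Require Import structures.
From mathcomp Require Import all_boot all_order all_algebra.
From mathcomp Require Import all_classical all_reals all_analysis.
From mathcomp Require Import ring lra.
Import Order.TTheory GRing.Theory Num.Theory.
Import numFieldNormedType.Exports.
Local Open Scope classical_set_scope.
Local Open Scope ring_scope.

(** * Euclidean inner product and norm on column vectors *)

Section InnerProduct.
Context {R : realType} {n : nat}.
Implicit Types (u v w : 'cV[R]_n) (A : 'M[R]_n) (S : set 'cV[R]_n) (a c : R).

Definition dot u v : R := (u^T *m v) 0 0.

(** An arbitrary set [S] is allowed, so that eigenvectors of many eigenvalues can be excluded at
    once without forming their span; the result is still a linear subspace. *)
Definition orth S : set 'cV[R]_n := [set w | forall v, S v -> dot v w = 0].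

Lemma dotE u v : dot u v = \sum_i u i 0 * v i 0.
Proof. by rewrite /dot mxE; apply: eq_bigr => i _; rewrite mxE. Qed.

Lemma dotC u v : dot u v = dot v u.
Proof. by rewrite !dotE; apply: eq_bigr => i _; rewrite mulrC. Qed.

Lemma dotDr u v w : dot u (v + w) = dot u v + dot u w.
Proof. by rewrite /dot mulmxDr mxE. Qed.

Lemma dotZr c u v : dot u (c *: v) = c * dot u v.
Proof. by rewrite /dot -scalemxAr mxE. Qed.

Lemma dotNr u v : dot u (- v) = - dot u v.
Proof. by rewrite /dot mulmxN mxE. Qed.

Lemma dotDl u v w : dot (v + w) u = dot v u + dot w u.
Proof. by rewrite dotC dotDr !(dotC u). Qed.

Lemma dotZl c u v : dot (c *: v) u = c * dot v u.
Proof. by rewrite dotC dotZr (dotC u). Qed.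

Lemma dotNl u v : dot (- v) u = - dot v u.
Proof. by rewrite dotC dotNr (dotC u). Qed.

Lemma dot0r u : dot u 0 = 0.
Proof. by rewrite /dot mulmx0 mxE. Qed.

Lemma dot0l u : dot 0 u = 0.
Proof. by rewrite dotC dot0r. Qed.

Definition dot_lin := (dotDl, dotDr, dotZl, dotZr, dotNl, dotNr).

Lemma dot_ge0 v : 0 <= dot v v.
Proof. by rewrite dotE; apply: sumr_ge0 => i _; rewrite -expr2 sqr_ge0. Qed.

Lemma dot_eq0 v : (dot v v == 0) = (v == 0).
Proof.
apply/idP/idP => [|/eqP->]; last by rewrite dot0r.
rewrite dotE psumr_eq0 => [/allP h|i _]; last by rewrite -expr2 sqr_ge0.
apply/eqP/colP => i; rewrite mxE; apply/eqP.
by have := h i (mem_index_enum _); rewrite /= -expr2 sqrf_eq0.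
Qed.

Lemma dot_gt0 v : (0 < dot v v) = (v != 0).
Proof. by rewrite lt0r dot_eq0 dot_ge0 andbT. Qed.

Lemma norm2_ge0 v : 0 <= norm2 v.
Proof. exact: sqrtr_ge0. Qed.

Lemma sqr_norm2 v : norm2 v ^+ 2 = dot v v.
Proof.
by rewrite /norm2 sqr_sqrtr ?dotE // sumr_ge0 // => i _; rewrite sqr_ge0.
Qed.

Lemma norm2_0 : norm2 (0 : 'cV[R]_n) = 0.
Proof. by apply/eqP; rewrite -sqrf_eq0 sqr_norm2 dot0r. Qed.

Lemma norm2Z c v : norm2 (c *: v) = `|c| * norm2 v.
Proof.
apply: (@pexpIrn _ 2); rewrite ?nnegrE ?mulr_ge0 ?norm2_ge0 //.
by rewrite exprMn real_normK ?num_real // !sqr_norm2 !dot_lin mulrA -expr2.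
Qed.

Lemma norm2_eq0 v : (norm2 v == 0) = (v == 0).
Proof. by rewrite -sqrf_eq0 sqr_norm2 dot_eq0. Qed.

Lemma norm2_gt0 v : (0 < norm2 v) = (v != 0).
Proof. by rewrite lt0r norm2_eq0 norm2_ge0 andbT. Qed.

(** Cauchy-Schwarz: expand the squared length of [dot u u *: v - dot u v *: u], which is
    nonnegative, and divide by [dot u u]. *)
Lemma dot_le_norm2 u v : dot u v <= norm2 u * norm2 v.
Proof.
have u0 := norm2_ge0 u; have v0 := norm2_ge0 v.
have [->|un0] := eqVneq u 0; first by rewrite dot0l mulr_ge0 // norm2_ge0.
have := dot_ge0 (dot u u *: v - dot u v *: u).
rewrite !dot_lin (dotC v u) => h.
have {}h : dot u u * (dot u v ^+ 2) <= dot u u * (dot u u * dot v v) by lra.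
move: h; rewrite ler_pM2l ?dot_gt0 // -!sqr_norm2 -exprMn => h.
have := ler_norm (dot u v); move/le_trans; apply.
by rewrite -(@ler_pXn2r _ 2) ?nnegrE ?mulr_ge0 // real_normK ?num_real.
Qed.

Lemma ler_norm2D u v : norm2 (u + v) <= norm2 u + norm2 v.
Proof.
have u0 := norm2_ge0 u; have v0 := norm2_ge0 v.
rewrite -(@ler_pXn2r _ 2) ?nnegrE ?addr_ge0 ?norm2_ge0 //.
rewrite sqr_norm2 !dot_lin (dotC v u) -!sqr_norm2.
by have := dot_le_norm2 u v; lra.
Qed.

Lemma continuous_dot (T : topologicalType) (f g : T -> 'cV[R]_n) :
  (forall i, continuous (fun t => f t i 0)) ->
  (forall i, continuous (fun t => g t i 0)) ->
  continuous (fun t => dot (f t) (g t)).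
Proof.
move=> cf cg; rewrite (_ : (fun _ => _) =
  (fun t => \sum_i f t i 0 * g t i 0)); last by apply/funext => t; rewrite dotE.
apply: continuous_big => [|i _ t]; first exact: add_continuous.
by apply: cvgM; [exact: cf | exact: cg].
Qed.

Lemma dot_continuous u : continuous (dot u).
Proof.
apply: (@continuous_dot _ (fun=> u) id) => i; last exact: coord_continuous.
exact: cst_continuous.
Qed.

End InnerProduct.

Lemma dot_mulmx {R : realType} {m n : nat} (A : 'M[R]_(m, n)) u v :
  dot u (A *m v) = dot (A^T *m u) v.
Proof. by rewrite /dot trmx_mul trmxK mulmxA. Qed.

(** For small [t] the linear term dominates. Every first-order optimality condition below is
    obtained this way. *)
Lemma quadratic_slope_ge0 (R : realType) (b e eps : R) :
  0 < eps -> (forall t, 0 < t <= eps -> 0 <= t * b + t ^+ 2 * e) -> 0 <= b.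
Proof.
move=> eps0 h; rewrite leNgt; apply/negP => b0.
have d0 : 0 < 2 * (`|e| + 1) by have := normr_ge0 e; lra.
(* With this [t] one has [t * |e| <= - b / 2], hence [b + t * e < 0]. *)
pose t := Num.min eps (- b / (2 * (`|e| + 1))).
have t0 : 0 < t by rewrite lt_min eps0 divr_gt0 // oppr_gt0.
have tb : t * (2 * (`|e| + 1)) <= - b by rewrite -ler_pdivlMr // ge_min lexx orbT.
have : 0 <= t * (b + t * e).
  have : 0 < t <= eps by rewrite t0 ge_min lexx.
  by move=> /h; rewrite mulrDr expr2 mulrA.
rewrite pmulr_rge0 // => bte.
have : t * e <= t * `|e| by rewrite ler_pM2l // ler_norm.
have : 0 <= t * `|e| by rewrite mulr_ge0 // ltW.
by lra.
Qed.

(** * Minimisation of the Rayleigh quotient on an invariant subspace *)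

Section Rayleigh.
Context {R : realType} {n : nat}.
Implicit Types (u v w : 'cV[R]_n) (A : 'M[R]_n) (S : set 'cV[R]_n) (a c : R).

Lemma orthD S u v : orth S u -> orth S v -> orth S (u + v).
Proof. by move=> Su Sv w Sw; rewrite dotDr Su // Sv // addr0. Qed.

Lemma orthZ S c v : orth S v -> orth S (c *: v).
Proof. by move=> Sv w Sw; rewrite dotZr Sv // mulr0. Qed.

Lemma orthB S u v : orth S u -> orth S v -> orth S (u - v).
Proof. by move=> Su Sv; rewrite -scaleN1r; apply: orthD => //; exact: orthZ. Qed.

(** The quadratic form attains its minimum on the compact unit sphere of [orth S]. The residual of
    the eigenvalue equation at the minimiser lies again in [orth S], and moving against it would
    lower the quotient unless it vanishes. *)
Lemma rayleigh_min A S : A^T = A ->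
  (forall w, orth S w -> orth S (A *m w)) ->
  (exists2 w, orth S w & w != 0) ->
  exists v a, [/\ orth S v, v != 0, A *m v = a *: v
    & forall w, orth S w -> a * dot w w <= dot w (A *m w)].
Proof.
move=> symA AS [w0 Sw0 w0n0].
(* The minimisation runs over row vectors, the form in which the extreme value theorem is applied;
   [w^T] leads back to columns. *)
have ctr i : continuous (fun w : 'rV[R]_n => w^T i 0).
  rewrite (_ : (fun _ => _) = (fun w : 'rV[R]_n => w 0 i)).
    exact: coord_continuous.
  by apply/funext => w; rewrite mxE.
have cAtr i : continuous (fun w : 'rV[R]_n => (A *m w^T) i 0).
  rewrite (_ : (fun _ => _) = (fun w : 'rV[R]_n => dot (row i A)^T w^T)).
    by apply: continuous_dot => // j; exact: cst_continuous.
  by apply/funext => w; rewrite mxE dotE; apply: eq_bigr => j _; rewrite !mxE.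
pose K : set 'rV[R]_n := [set w | dot w^T w^T = 1 /\ orth S w^T].
have unitK w : orth S w -> w != 0 -> K ((norm2 w)^-1 *: w)^T.
  move=> Sw wn0; rewrite /K /= trmxK; split; last exact: orthZ.
  rewrite !dot_lin -sqr_norm2; have : norm2 w != 0 by rewrite norm2_eq0.
  by move=> ?; field.
have K0 : K !=set0 by exists ((norm2 w0)^-1 *: w0)^T; exact: unitK.
have cK : compact K.
  apply: bounded_closed_compact.
    exists 1; split => // M M1 w [/= w1 _]; apply: le_trans (ltW M1).
    rewrite [leLHS]/Num.norm /= mx_normrE; apply/bigmax_leP; split => //= -[i j] _.
    rewrite /= (ord1 i) -(@ler_pXn2r _ 2) ?nnegrE // real_normK ?num_real //.
    rewrite expr1n -w1 dotE (bigD1 j) //= !mxE -expr2 lerDl.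
    by apply: sumr_ge0 => k _; rewrite -expr2 sqr_ge0.
  rewrite (_ : K = (fun w : 'rV[R]_n => dot w^T w^T) @^-1` [set 1] `&`
     \bigcap_(v in S) ((fun w : 'rV[R]_n => dot v w^T) @^-1` [set 0])).
    apply: closedI.
      apply: preimage_closed; last exact: closed_eq.
      by move=> w _; exact: continuous_dot.
    apply: closed_bigI => v _; apply: preimage_closed; last exact: closed_eq.
    by move=> w _; apply: continuous_dot => // j; exact: cst_continuous.
  by apply/seteqP; split => w.
have := @EVT_min_rV R n (fun w : 'rV[R]_n => dot w^T (A *m w^T)) K K0 cK.
case=> [|c /set_mem [c1 Sc] cmin].
  by apply: continuous_subspaceT; exact: continuous_dot.
pose a := dot c^T (A *m c^T).
have cn0 : c^T != 0 by rewrite -dot_eq0 c1 oner_eq0.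
have min w : orth S w -> a * dot w w <= dot w (A *m w).
  move=> Sw; have [->|wn0] := eqVneq w 0; first by rewrite !dot0l mulr0.
  have := cmin _ (mem_set (unitK w Sw wn0)).
  rewrite -/a trmxK -scalemxAr !dot_lin -sqr_norm2 mulrA -expr2 => h.
  have w2_gt0 : 0 < norm2 w ^+ 2 by rewrite sqr_norm2 dot_gt0.
  by rewrite -ler_pdivlMr // mulrC -exprVn.
exists c^T, a; split => //; apply/eqP; rewrite -subr_eq0.
move Eg : (A *m c^T - a *: c^T) => g.
have Sg : orth S g by rewrite -Eg; apply: orthB; [exact: AS | exact: orthZ].
have gAc : dot g (A *m c^T) = dot g g + a * dot g c^T.
  apply/eqP; rewrite -subr_eq; apply/eqP.
  by rewrite -dotZr -dotNr -dotDr Eg.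
(* At [c^T - t g] the form minus [a] times the squared norm has value 0 at [t = 0] and slope
   [- 2 |g|^2] there. *)
have : 0 <= - (2 * dot g g).
  apply: (@quadratic_slope_ge0 _ _ (dot g (A *m g) - a * dot g g) 1) => // t _.
  have := min (c^T + (- t) *: g) (orthD _ _ _ Sc (orthZ _ _ _ Sg)).
  rewrite mulmxDr -scalemxAr !dot_lin c1 -/a.
  rewrite (dot_mulmx A c^T g) symA (dotC (A *m c^T) g) (dotC c^T g) gAc.
  by lra.
by rewrite oppr_ge0 pmulr_rle0 // -dot_eq0 eq_le dot_ge0 andbT.
Qed.

End Rayleigh.

Lemma setminE {R : realType} (A : set R) a : A a -> lbound A a -> setmin A = a.
Proof.
move=> Aa lba; rewrite /setmin; case: xgetP => [b _ [Ab lbb]|/(_ a)[]//].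
by apply/eqP; rewrite eq_le lba // lbb.
Qed.

Lemma setmaxE {R : realType} (A : set R) a : A a -> ubound A a -> setmax A = a.
Proof.
move=> Aa uba; rewrite /setmax; case: xgetP => [b _ [Ab ubb]|/(_ a)[]//].
by apply/eqP; rewrite eq_le uba // ubb.
Qed.

Lemma setmax0 {R : realType} (A : set R) : ~ (A !=set0) -> setmax A = 0.
Proof.
by move=> A0; rewrite /setmax; case: xgetP => [b _ [Ab _]|//]; case: A0; exists b.
Qed.

(** * Least eigenvalue of a symmetric matrix, and the spectral norm *)

Section SymmetricSpectrum.
Context {R : realType} {n : nat}.
Implicit Types (u v w : 'cV[R]_n) (A B : 'M[R]_n).

(** [eigenvalue] refers to row eigenvectors; symmetry turns them into columns by transposition. *)
Lemma eigenvalue_symP A a : A^T = A ->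
  eigenvalue A a <-> exists2 v : 'cV[R]_n, A *m v = a *: v & v != 0.
Proof.
move=> symA; split=> [/eigenvalueP[v vA v0]|[v Av v0]].
  exists v^T; last by rewrite trmx_eq0.
  by rewrite -[A]symA -trmx_mul vA linearZ.
apply/eigenvalueP; exists v^T; last by rewrite trmx_eq0.
by rewrite -{1}symA -trmx_mul Av linearZ.
Qed.

Lemma orth0 w : orth set0 w.
Proof. by []. Qed.

(** Case [S = set0] of [rayleigh_min], where the orthogonal is the whole space. The nonzero vector
    rules out dimension 0, where there is no eigenvalue. *)
Lemma lambda_min_rayleigh A : A^T = A -> (exists w : 'cV[R]_n, w != 0) ->
  eigenvalue A (lambda_min A) /\
  forall w, lambda_min A * dot w w <= dot w (A *m w).
Proof.
move=> symA [w0 w0n0].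
have [v [a [_ vn0 Av amin]]] : exists v a, [/\ orth set0 v, v != 0, A *m v = a *: v
    & forall w, orth set0 w -> a * dot w w <= dot w (A *m w)].
  apply: rayleigh_min symA _ _ => [w _|]; first exact: orth0.
  by exists w0; first exact: orth0.
have eiga : eigenvalue A a by apply/eigenvalue_symP => //; exists v.
suff -> : lambda_min A = a by split => // w; exact: amin.
apply: setminE => // b /(eigenvalue_symP _ _ symA)[w Aw wn0].
by have := amin w (orth0 w); rewrite Aw dotZr ler_pM2r // dot_gt0.
Qed.

(** The least eigenvalue of [- A^T A] bounds [|A w|^2] from above. This makes the supremum in
    [opnorm2] one of a bounded set. *)
Lemma norm2_mulmx_bounded A :
  exists c, forall w, norm2 (A *m w) ^+ 2 <= c * norm2 w ^+ 2.
Proof.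
have symB : (- (A^T *m A))^T = - (A^T *m A) by rewrite linearN /= trmx_mul trmxK.
have [[w0 w0n0]|all0] := pselect (exists w : 'cV[R]_n, w != 0).
  have [_ minB] := lambda_min_rayleigh _ symB (ex_intro _ w0 w0n0).
  exists (- lambda_min (- (A^T *m A))) => w.
  have := minB w; rewrite mulNmx dotNr -mulmxA dot_mulmx trmxK !sqr_norm2.
  by lra.
exists 0 => w; have /negP/negPn/eqP-> : ~ (w != 0) by move=> ?; apply: all0; exists w.
by rewrite mulmx0 norm2_0 expr0n mulr0.
Qed.

Lemma norm2_mulmx_le A w : norm2 (A *m w) <= opnorm2 A * norm2 w.
Proof.
have [c Ac] := norm2_mulmx_bounded A.
have [->|wn0] := eqVneq w 0; first by rewrite mulmx0 norm2_0 mulr0.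
have w0 : 0 < norm2 w by rewrite norm2_gt0.
rewrite -ler_pdivrMr //; apply: ub_le_sup.
  exists (`|c| + 1) => _ [v /= v1 <-].
  have v2 : norm2 v ^+ 2 <= 1 by rewrite expr_le1 ?norm2_ge0.
  have : c * norm2 v ^+ 2 <= `|c|.
    apply: le_trans (ler_norm _) _; rewrite normrM (ger0_norm (sqr_ge0 _)).
    by rewrite ler_piMr.
  have := Ac v; have := normr_ge0 c; have := norm2_ge0 (A *m v).
  by nra.
exists ((norm2 w)^-1 *: w) => /=; rewrite -?scalemxAr norm2Z gtr0_norm ?invr_gt0 //.
  by rewrite mulVf ?gt_eqF.
by rewrite mulrC.
Qed.

Lemma opnorm2_ge0 A : 0 <= opnorm2 A.
Proof.
have [[w w0]|all0] := pselect (exists w : 'cV[R]_n, w != 0).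
  have := norm2_mulmx_le A w; move/(le_trans (norm2_ge0 _)).
  by rewrite pmulr_lge0 // norm2_gt0.
rewrite /opnorm2 (_ : [set _ | _ in _] = [set 0]) ?sup1 //.
apply/seteqP; split => [_ [w _ <-]|_ ->] /=.
  have /negP/negPn/eqP-> : ~ (w != 0) by move=> ?; apply: all0; exists w.
  by rewrite mulmx0 norm2_0.
by exists 0; rewrite ?mulmx0 /= norm2_0.
Qed.

Lemma dot_mulmx_le_opnorm2 A w : dot w (A *m w) <= opnorm2 A * norm2 w ^+ 2.
Proof.
apply: le_trans (dot_le_norm2 _ _) _; rewrite expr2 mulrCA.
by rewrite ler_wpM2l ?norm2_ge0 // norm2_mulmx_le.
Qed.

End SymmetricSpectrum.

(** * Spectrum of the proximal matrix and contraction of its recursion *)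

Section ProximalMatrix.
Context {R : realType} {n : nat}.
Context (A : 'M[R]_n) (g delta : R) (symA : A^T = A).
Context (delta_gt0 : 0 < delta) (delta_le : delta <= g).
Context (shift_ge : forall w, delta * dot w w <= dot w (A *m w) + g * dot w w).
Implicit Types (u v w : 'cV[R]_n).

Let M := g *: invmx (A + g%:M).
Let rho := setmax [set a | eigenvalue M a /\ a < 1].
Let pos_spec := [set a | eigenvalue A a /\ 0 < a].

(** The orthogonal of this set plays the role of the span of the eigenvectors with positive
    eigenvalue. *)
Let nonpos_vec := [set v : 'cV[R]_n | exists2 a, a <= 0 & A *m v = a *: v].

Lemma shift_gt0 : 0 < g.
Proof. exact: lt_le_trans delta_gt0 delta_le. Qed.

Lemma shift_eigenvalue_gt0 b : eigenvalue A b -> 0 < g + b.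
Proof.
move=> /(eigenvalue_symP _ _ symA)[v Av v0].
have := shift_ge v; rewrite Av dotZr -mulrDl addrC ler_pM2r ?dot_gt0 //.
exact: lt_le_trans.
Qed.

Lemma shift_unitmx : A + g%:M \in unitmx.
Proof.
rewrite unitmxE unitfE; apply/negP => /det0P[v v0 vB].
have vA : v *m A = (- g) *: v.
  by apply/eqP; rewrite -subr_eq0 scaleNr opprK -mul_mx_scalar -mulmxDr vB.
have : eigenvalue A (- g) by apply/eigenvalueP; exists v.
by move=> /shift_eigenvalue_gt0; rewrite subrr ltxx.
Qed.

(** [A] and [M] share their eigenvectors, and the eigenvalues correspond under
    [b -> g / (g + b)]. *)
Lemma eigenvalue_proxP a :
  eigenvalue M a <-> exists2 b, eigenvalue A b & a = g / (g + b).
Proof.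
have g0 := shift_gt0; have uB := shift_unitmx; split.
  move=> /eigenvalueP[v vM v0].
  have gv : g *: v = a *: (v *m (A + g%:M)).
    by rewrite scalemxAl -vM -scalemxAr -scalemxAl mulmxKV.
  have a0 : a != 0.
    apply: contraNneq v0 => a0; move/eqP: gv.
    by rewrite a0 scale0r scaler_eq0 gt_eqF.
  (* This inverts [b -> g / (g + b)]. *)
  exists (g / a - g); last by rewrite addrC subrK invf_div mulrC divfK ?gt_eqF.
  apply/eigenvalueP; exists v => //.
  apply: (scalerI a0); move: gv; rewrite mulmxDr mul_mx_scalar scalerDr scalerA.
  move/(canLR (addrK _)) <-; rewrite -scalerBl scalerA; congr (_ *: _).
  by field.
move=> [b bA ->]; have gb := shift_eigenvalue_gt0 _ bA.
move/eigenvalueP: bA => [v vA v0]; apply/eigenvalueP; exists v => //.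
have vB : v *m (A + g%:M) = (g + b) *: v.
  by rewrite mulmxDr mul_mx_scalar vA -scalerDl addrC.
have gbn0 : g + b != 0 by rewrite gt_eqF.
rewrite -scalemxAr -scalerA; congr (_ *: _); apply: (scalerI gbn0).
by rewrite scalemxAl -vB mulmxK // scalerA divff // scale1r.
Qed.

Lemma prox_lt1 b : 0 < g + b -> (g / (g + b) < 1) = (0 < b).
Proof. by move=> gb; rewrite ltr_pdivrMr // mul1r ltrDl. Qed.

Lemma orth_nonpos_stable w : orth nonpos_vec w -> orth nonpos_vec (A *m w).
Proof.
move=> Ww v Nv; have [a _ Av] := Nv.
by rewrite dot_mulmx symA Av dotZl Ww // mulr0.
Qed.

Lemma orth_nonpos_pos b w : 0 < b -> A *m w = b *: w -> orth nonpos_vec w.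
Proof.
move=> b0 Aw v [a a0 Av].
have : dot v (A *m w) = dot (A *m v) w by rewrite dot_mulmx symA.
rewrite Aw Av dotZl dotZr => /eqP; rewrite -subr_eq0 -mulrBl mulf_eq0.
by case/orP => [|/eqP //]; rewrite subr_eq0 gt_eqF // (le_lt_trans a0).
Qed.

(** Minimise the Rayleigh quotient over the invariant subspace [orth nonpos_vec]. The minimum is a
    positive eigenvalue, since otherwise its eigenvector would be orthogonal to itself; it is the
    least one, since every eigenvector with positive eigenvalue lies in this subspace. *)
Lemma least_pos_eigenvalue : (exists2 w, orth nonpos_vec w & w != 0) ->
  exists lam, [/\ pos_spec lam, lbound pos_spec lam
    & forall w, orth nonpos_vec w -> lam * dot w w <= dot w (A *m w)].
Proof.
move=> Wn0.
have [v [a [Wv v0 Av amin]]] := rayleigh_min _ _ symA orth_nonpos_stable Wn0.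
have a0 : 0 < a.
  rewrite ltNge; apply/negP => a_le0; move/negP: v0; apply.
  by rewrite -dot_eq0; apply/eqP/Wv; exists a.
exists a; split => //.
  by split => //; apply/eigenvalue_symP => //; exists v.
move=> b [/(eigenvalue_symP _ _ symA)[w Aw w0] b0].
have := amin w (orth_nonpos_pos _ _ b0 Aw).
by rewrite Aw dotZr ler_pM2r // dot_gt0.
Qed.

Lemma pos_spec_orth : (exists2 a, eigenvalue A a & 0 < a) ->
  exists2 w, orth nonpos_vec w & w != 0.
Proof.
move=> [a /(eigenvalue_symP _ _ symA)[w Aw w0] a0].
by exists w => //; exact: orth_nonpos_pos Aw.
Qed.

(** The map [b -> g / (g + b)] decreases and is below 1 exactly for [b > 0], so the largest
    eigenvalue of [M] below 1 comes from the least positive [b]. *)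
Lemma prox_rateE lam : pos_spec lam -> lbound pos_spec lam -> rho = g / (g + lam).
Proof.
move=> [eiglam lam0] lamlb; have glam := shift_eigenvalue_gt0 _ eiglam.
apply: setmaxE => [|a [/eigenvalue_proxP[b eigb ->]]].
  by split; [apply/eigenvalue_proxP; exists lam | rewrite prox_lt1].
have gb := shift_eigenvalue_gt0 _ eigb; rewrite prox_lt1 // => b0.
by rewrite ler_pM2l ?shift_gt0 // lef_pV2 ?posrE // lerD2l lamlb.
Qed.

Lemma prox_rateP : (exists2 a, eigenvalue A a & 0 < a) ->
  [/\ eigenvalue M rho, rho = g / (g + setmin pos_spec) & 0 < rho < 1].
Proof.
move=> /pos_spec_orth/least_pos_eigenvalue[lam [Plam lblam _]].
have [eiglam lam0] := Plam; have glam := shift_eigenvalue_gt0 _ eiglam.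
rewrite (setminE _ _ Plam lblam) (prox_rateE _ Plam lblam); split => //.
  by apply/eigenvalue_proxP; exists lam.
by rewrite prox_lt1 // divr_gt0 ?shift_gt0.
Qed.

Lemma prox_rate_itv : 0 <= rho < 1.
Proof.
have [/prox_rateP[_ _ /andP[/ltW -> ->]]//|nopos] :=
  pselect (exists2 a, eigenvalue A a & 0 < a).
(* Without positive eigenvalues of [A] no eigenvalue of [M] is below 1, and [rho] is the default
   0. *)
rewrite /rho setmax0 ?lexx ?ltr01 // => -[a [/eigenvalue_proxP[b eigb ->]]].
rewrite prox_lt1; last exact: shift_eigenvalue_gt0.
by move=> b0; apply: nopos; exists b.
Qed.

(* Pairing [(A + g) e = g d] with [e] and bounding [A] below on the orthogonal
   of the nonpositive eigenvectors gives [(lam + g) |e|^2 <= g |e| |d|]. *)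
Lemma prox_contraction d e : orth nonpos_vec e -> A *m e + g *: e = g *: d ->
  norm2 e <= rho * norm2 d.
Proof.
move=> We eqe; have /andP[rho0 _] := prox_rate_itv.
have [->|en0] := eqVneq e 0; first by rewrite norm2_0 mulr_ge0 ?norm2_ge0.
have [lam [Plam lblam minlam]] := least_pos_eigenvalue (ex_intro2 _ _ e We en0).
rewrite (prox_rateE _ Plam lblam) mulrAC.
have glam := shift_eigenvalue_gt0 _ (proj1 Plam).
rewrite ler_pdivlMr // -(@ler_pM2l _ (norm2 e)) ?norm2_gt0 //.
have -> : norm2 e * (norm2 e * (g + lam)) = lam * dot e e + g * dot e e.
  by rewrite -sqr_norm2; ring.
apply: (@le_trans _ _ (dot e (g *: d))).
  by rewrite -eqe dotDr dotZr lerD2r minlam.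
by rewrite dotZr mulrCA ler_pM2l ?shift_gt0 // dot_le_norm2.
Qed.

(** Each step multiplies the component along an eigenvector with eigenvalue [a <= 0] by
    [g / (g + a) >= 1]. Its absolute value is nondecreasing with limit 0, hence is 0 throughout. *)
Lemma prox_orbit_orth (d : nat -> 'cV[R]_n) :
  (forall k, A *m d k.+1 + g *: d k.+1 = g *: d k) ->
  (forall v, dot v (d k) @[k --> \oo] --> (0 : R)) ->
  forall k, orth nonpos_vec (d k).
Proof.
move=> rec cvgd k v [a a0 Av].
have [->|v0] := eqVneq v 0; first by rewrite dot0l.
have ga : 0 < g + a.
  by apply: shift_eigenvalue_gt0; apply/eigenvalue_symP => //; exists v.
have step j : (g + a) * dot v (d j.+1) = g * dot v (d j).
  rewrite -[RHS]dotZr -rec dotDr dotZr dot_mulmx symA Av dotZl.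
  by ring.
have incr : nondecreasing_seq (fun j => `|dot v (d j)|).
  apply/nondecreasing_seqP => j.
  rewrite -(@ler_pM2l _ g) ?shift_gt0 // -{1}(gtr0_norm shift_gt0) -normrM -step.
  by rewrite normrM gtr0_norm // ler_wpM2r // gerDl.
have cvg0 : `|dot v (d j)| @[j --> \oo] --> (0 : R).
  by rewrite -(normr0 R); apply: cvg_norm; exact: cvgd.
have := nondecreasing_cvgn_le incr (cvgP _ cvg0) k.
by rewrite (cvg_lim _ cvg0) // normr_le0 => /eqP.
Qed.

End ProximalMatrix.

(** * First-order conditions of the proximal step on the box, and identification of the active
    set *)

Section BoxProximalStep.
Context {R : realType} {n : nat}.
Context (Q : 'M[R]_n) (r l u : 'cV[R]_n) (g : R) (symQ : Q^T = Q).
Implicit Types (x y p h : 'cV[R]_n) (j : 'I_n) (S : set 'cV[R]_n).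

Let q := quad Q r.
Let prox p y : R := q y + g / 2 * norm2 (y - p) ^+ 2.
Let grad y : 'cV[R]_n := Q *m y + r.

Lemma dot_delta y j : dot y (delta_mx j 0) = y j 0.
Proof.
rewrite dotE (bigD1 j) //= big1 => [|i /negPf ij].
  by rewrite mxE !eqxx mulr1 addr0.
by rewrite mxE ij mulr0.
Qed.

Lemma quadE y : q y = 2^-1 * dot y (Q *m y) + dot r y.
Proof. by rewrite /q /quad -mulmxA. Qed.

(** Exact second-order Taylor formula; symmetry of [Q] merges the two cross terms. *)
Lemma quadD y h : q (y + h) = q y + dot (grad y) h + 2^-1 * dot h (Q *m h).
Proof.
rewrite !quadE mulmxDr !dot_lin (dot_mulmx Q y h) symQ (dotC h (Q *m y)).
by field.
Qed.

Lemma partial_quad j y : partial q j y = grad y j 0.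
Proof.
rewrite -dot_delta /partial /derive; set e := delta_mx j 0.
apply: cvg_lim => //.
(* For [t != 0] the difference quotient is exactly [dot (grad y) e + t * c]. *)
pose c := 2^-1 * dot e (Q *m e).
apply: (@cvg_trans _ ((fun t : R => dot (grad y) e + t * c) @ 0^')).
  apply: near_eq_cvg; near=> t.
  have t0 : t != 0 by near: t; exact: nbhs_dnbhs_neq.
  rewrite /= (addrC (t *: e)) quadD -scalemxAr !dot_lin /c -[_ *: _]/(_ * _).
  by field.
have : (fun t : R => dot (grad y) e + t * c) @ 0^' --> dot (grad y) e + 0 * c.
  apply: cvgD; first exact: cvg_cst.
  apply: cvgMr_tmp; apply: nbhs_dnbhs.
by rewrite mul0r addr0.
Unshelve. all: by end_near. Qed.

Lemma prox_stepE p y h t : prox p (y + t *: h) = prox p y +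
  t * dot (grad y + g *: (y - p)) h
  + t ^+ 2 * (2^-1 * (dot h (Q *m h) + g * dot h h)).
Proof.
rewrite /prox quadD addrAC !sqr_norm2 -scalemxAr !dot_lin.
rewrite (dotC h y) (dotC h p) (dotC p y).
by field.
Qed.

Lemma argmin_prox_slope S p y h eps : argmin S (prox p) y -> 0 < eps ->
  (forall t, 0 < t <= eps -> S (y + t *: h)) ->
  0 <= dot (grad y + g *: (y - p)) h.
Proof.
move=> [Sy miny] eps0 Sh.
apply: (@quadratic_slope_ge0 _ _
  (2^-1 * (dot h (Q *m h) + g * dot h h)) _ eps0) => t teps.
have := miny _ (Sh t teps); rewrite prox_stepE -addrA lerDl.
by [].
Qed.

Lemma box_line y j t : box l u y -> l j 0 <= y j 0 + t <= u j 0 ->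
  box l u (y + t *: delta_mx j 0).
Proof.
move=> by_ ht i; rewrite !mxE; have [->|ij] := eqVneq i j.
  by rewrite eqxx mulr1.
by rewrite mulr0 addr0; exact: by_.
Qed.

(** Below its upper bound a coordinate can be increased within the box, so the slope of the proximal
    objective in that direction is nonnegative. The next lemma is the mirror image. *)
Lemma argmin_prox_ge0 p y j : argmin (box l u) (prox p) y -> y j 0 < u j 0 ->
  0 <= (grad y + g *: (y - p)) j 0.
Proof.
move=> miny yu; have [boxy _] := miny; rewrite -dot_delta.
have eps0 : 0 < u j 0 - y j 0 by rewrite subr_gt0.
apply: (argmin_prox_slope _ _ _ _ _ miny eps0) => t /andP[t0 tu].
apply: box_line => //; have := boxy j; move: t0 tu.
by move=> ? ? /andP[? ?]; apply/andP; split; lra.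
Qed.

Lemma argmin_prox_le0 p y j : argmin (box l u) (prox p) y -> l j 0 < y j 0 ->
  (grad y + g *: (y - p)) j 0 <= 0.
Proof.
move=> miny yl; have [boxy _] := miny; rewrite -dot_delta -oppr_ge0 -dotNr.
have eps0 : 0 < y j 0 - l j 0 by rewrite subr_gt0.
apply: (argmin_prox_slope _ _ _ _ _ miny eps0) => t /andP[t0 tu].
rewrite scalerN -scaleNr.
apply: box_line => //; have := boxy j; move: t0 tu.
by move=> ? ? /andP[? ?]; apply/andP; split; lra.
Qed.

Lemma cvg_coord (x : nat -> 'cV[R]_n) (xbar : 'cV[R]_n) j :
  x k @[k --> \oo] --> xbar -> x k j 0 @[k --> \oo] --> xbar j 0.
Proof.
move=> cvgx; apply: (cvg_comp x (fun y => y j 0) cvgx).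
exact: coord_continuous.
Qed.

Lemma cvg_dot (x : nat -> 'cV[R]_n) (xbar v : 'cV[R]_n) :
  x k @[k --> \oo] --> xbar -> dot v (x k) @[k --> \oo] --> dot v xbar.
Proof.
by move=> cvgx; apply: (cvg_comp x (dot v) cvgx); exact: dot_continuous.
Qed.

(** The gradient of the proximal objective at [x k.+1] tends to [grad xbar], because consecutive
    iterates merge. At an active coordinate its strict sign persists, which contradicts the
    one-sided conditions if the iterate is off the bound. A free coordinate stays strictly inside
    its bounds, where both conditions apply. *)
Lemma prox_active_set_identification (x : nat -> 'cV[R]_n) (xbar : 'cV[R]_n) :
  (forall k, argmin (box l u) (prox (x k)) (x k.+1)) ->
  x k @[k --> \oo] --> xbar -> strict_complementarity l u q xbar ->
  \forall k \near \oo, forall j,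
    (j \notin act_m l u xbar -> x k.+1 j 0 = xbar j 0) /\
    (j \in act_m l u xbar ->
      (grad (x k.+1) + g *: (x k.+1 - x k)) j 0 = 0).
Proof.
move=> xmin cvgx [[boxbar _ _ _] scl scu]; apply: filter_forall => j.
have cvgxS : x k.+1 @[k --> \oo] --> xbar by rewrite cvg_shiftS.
have gradE y p : (grad y + g *: (y - p)) j 0 =
    dot (row j Q)^T y + r j 0 + g * (y j 0 - p j 0).
  by rewrite {1}/dot trmxK -row_mul /grad !mxE.
have cvgG : (grad (x k.+1) + g *: (x k.+1 - x k)) j 0 @[k --> \oo]
    --> grad xbar j 0.
  rewrite (_ : grad xbar j 0 = (grad xbar + g *: (xbar - xbar)) j 0); last first.
    by rewrite subrr scaler0 addr0.
  rewrite gradE (_ : (fun _ => _) = (fun k => dot (row j Q)^T (x k.+1) + r j 0 +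
    g * (x k.+1 j 0 - x k j 0))); last by apply/funext => k; exact: gradE.
  apply: cvgD; first by apply: cvgD; [exact: cvg_dot | exact: cvg_cst].
  by apply: cvgMl_tmp; apply: cvgB; exact: cvg_coord.
have /andP[lx xu] := boxbar j.
have [mj|nmj] := boolP (j \in act_m l u xbar).
  have {lx xu}/andP[lx xu] : l j 0 < xbar j 0 < u j 0.
    by move: mj; rewrite inE.
  near=> k; split=> // _; apply/eqP; rewrite eq_le.
  rewrite (argmin_prox_le0 _ _ _ (xmin k)) ?(argmin_prox_ge0 _ _ _ (xmin k)) //.
    near: k; exact: (cvgr_lt _ (cvg_coord _ _ j cvgxS)).
  near: k; exact: (cvgr_gt _ (cvg_coord _ _ j cvgxS)).
have [lj|nlj] := boolP (j \in act_l l xbar).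
  have := scl j lj; rewrite partial_quad => G0.
  have := lj; rewrite inE => /eqP ->.
  near=> k; split=> // _; apply/eqP; rewrite eq_le.
  have [/(_ j)/andP[-> _] _] := xmin k; rewrite andbT leNgt; apply/negP.
  move/(argmin_prox_le0 _ _ _ (xmin k)); apply/negP; rewrite -ltNge.
  near: k; exact: (cvgr_gt _ cvgG).
have uj : j \in act_u u xbar.
  move: nmj nlj; rewrite !inE negb_and -!leNgt => /orP[xl|ux].
    by rewrite eq_le xl lx.
  by move=> _; rewrite eq_le xu ux.
have := scu j uj; rewrite partial_quad => G0.
have := uj; rewrite inE => /eqP ->.
near=> k; split=> // _; apply/eqP; rewrite eq_le.
have [/(_ j)/andP[_ ->] _] := xmin k; rewrite leNgt; apply/negP.
move/(argmin_prox_ge0 _ _ _ (xmin k)); apply/negP; rewrite -ltNge.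
near: k; exact: (cvgr_lt _ cvgG).
Unshelve. all: by end_near. Qed.

End BoxProximalStep.

(** * Restriction to, and extension by zero from, a set of coordinates *)

Section FreeCoordinates.
Context {R : realType} {n : nat} (I : {set 'I_n}).

(** Its columns are the unit vectors indexed by [I]: it extends by zero, and its transpose restricts
    to [I]. *)
Definition incl_mx : 'M[R]_(n, #|I|) := colsub (fun i => enum_val i) 1%:M.

Lemma tr_incl_mx_mul (v : 'cV[R]_n) i :
  (incl_mx^T *m v) i 0 = v (enum_val i) 0.
Proof. by rewrite /incl_mx trmx_mxsub trmx1 mul_rowsub_mx mul1mx mxE. Qed.

Lemma principal_submxE (A : 'M[R]_n) :
  principal_submx I A = incl_mx^T *m A *m incl_mx.
Proof.
rewrite /incl_mx trmx_mxsub trmx1 mul_rowsub_mx mul1mx mulmx_colsub mulmx1.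
by apply/matrixP => i j; rewrite !mxE.
Qed.

Lemma incl_mxK : incl_mx^T *m incl_mx = 1%:M.
Proof.
rewrite /incl_mx trmx_mxsub trmx1 mul_rowsub_mx mul1mx.
by apply/matrixP => i j; rewrite !mxE (inj_eq enum_val_inj).
Qed.

Lemma dot_incl_mx (v w : 'cV[R]_#|I|) : dot (incl_mx *m v) (incl_mx *m w) = dot v w.
Proof. by rewrite dot_mulmx mulmxA incl_mxK mul1mx. Qed.

Lemma norm2_incl_mx (v : 'cV[R]_#|I|) : norm2 (incl_mx *m v) = norm2 v.
Proof.
by apply: (@pexpIrn _ 2); rewrite ?nnegrE ?norm2_ge0 // !sqr_norm2 dot_incl_mx.
Qed.

Lemma incl_mx_restrict (v : 'cV[R]_n) : (forall j, j \notin I -> v j 0 = 0) ->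
  incl_mx *m (incl_mx^T *m v) = v.
Proof.
move=> v0; apply/colP => j; rewrite [LHS]mxE.
have [jI|jI] := boolP (j \in I); last first.
  rewrite v0 // big1 // => i _; rewrite !mxE; case: eqP => [jE|_]; rewrite ?mul0r //.
  by move: jI; rewrite jE enum_valP.
rewrite (bigD1 (enum_rank_in jI j)) //= big1 ?addr0 => [|i ij].
  by rewrite tr_incl_mx_mul !mxE enum_rankK_in // eqxx mul1r.
rewrite !mxE; case: eqP => [jE|_]; last by rewrite mul0r.
by move/eqP: ij; case; rewrite [X in enum_rank_in _ X]jE enum_valK_in.
Qed.

End FreeCoordinates.

(** * Linear convergence through the recursion on the free coordinates *)

Theorem theorem1 (R : realType) (n : nat)
    (Q : 'M[R]_n) (r l u : 'cV[R]_n) (delta : R)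
    (x : nat -> 'cV[R]_n) (xbar : 'cV[R]_n) :
  let q := quad Q r in
  let Omega := box l u in
  let gamma := delta - lambda_min Q in
  let Qmm := principal_submx (act_m l u xbar) Q in
  let Mbar := gamma *: invmx (Qmm + gamma%:M) in
  let rho := setmax [set a | eigenvalue Mbar a /\ a < 1] in
  Q^T = Q ->
  ~ posdefmx Q ->
  (-oo < ereal_inf [set (q y)%:E | y in Omega])%E ->
  0 < delta ->
  (forall k, argmin Omega
     (fun y => q y + gamma / 2 * norm2 (y - x k) ^+ 2) (x k.+1)) ->
  x k @[k --> \oo] --> xbar ->
  strict_complementarity l u q xbar ->
  (* rho is the maximum of a nonempty set as soon as Qmm has a positive
     eigenvalue; otherwise rho = 0 *)
  ((exists2 a, eigenvalue Qmm a & 0 < a) ->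
     [/\ eigenvalue Mbar rho,
         rho = gamma / (gamma + setmin [set a | eigenvalue Qmm a /\ 0 < a])
       & 0 < rho < 1]) /\
  exists N : nat, (0 < N)%N /\ forall k : nat, (N <= k)%N ->
    [/\ norm2 (x k.+1 - x k.+2) <= rho * norm2 (x k - x k.+1),
        norm2 (x k.+1 - xbar) <= rho * norm2 (x k - xbar)
      & q (x k) - q xbar <=
          opnorm2 Qmm * rho ^+ (2 * (k - N)) / (2 * (1 - rho) ^+ 2)
          * norm2 (x N - x N.+1) ^+ 2].
Proof.
move=> q Omega gamma Qmm Mbar rho symQ npdQ _ delta0 xmin cvgx sc.
pose I := act_m l u xbar; pose E : 'M[R]_(n, #|I|) := incl_mx I.
have QmmE : Qmm = E^T *m Q *m E by exact: principal_submxE.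
have symQmm : Qmm^T = Qmm by rewrite QmmE !trmx_mul trmxK symQ mulmxA.
(* The vector [v0] witnesses [lambda_min Q <= 0], whence [delta <= gamma]; it also shows that the
   dimension is not 0. *)
have [v0 v0n0 v0Q] : exists2 v : 'cV[R]_n, v != 0 & dot v (Q *m v) <= 0.
  apply: contrapT => h; apply: npdQ => v vn0; rewrite -mulmxA ltNge.
  by apply/negP => vQ; apply: h; exists v.
have [_ minQ] := lambda_min_rayleigh _ symQ (ex_intro _ v0 v0n0).
have delta_le : delta <= gamma.
  rewrite lerDl oppr_ge0 -(@pmulr_lle0 _ (dot v0 v0)) ?dot_gt0 //.
  exact: le_trans (minQ v0) v0Q.
have shift_ge (w : 'cV[R]_#|I|) :
    delta * dot w w <= dot w (Qmm *m w) + gamma * dot w w.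
  have := minQ (E *m w); rewrite dot_incl_mx => h.
  rewrite QmmE -!mulmxA dot_mulmx trmxK /gamma mulrBl.
  by lra.
split; first exact: (prox_rateP _ _ _ symQmm delta0 delta_le shift_ge).
have [rho0 rho1] := andP (prox_rate_itv _ _ _ symQmm delta0 delta_le shift_ge).
have [N0 _ ident] :=
  prox_active_set_identification _ _ _ _ _ symQ _ _ xmin cvgx sc.
(* Identification at index [k] concerns [x k.+1], so [x N] itself is pinned only from [N = N0.+1]
   on. *)
exists N0.+1; split => // k Nk; set N := N0.+1.
have identN m : (forall j, j \notin I -> (x (m + N)%N - xbar) j 0 = 0) /\
    E^T *m (Q *m x (m + N).+1 + r + gamma *: (x (m + N).+1 - x (m + N)%N)) = 0.
  split=> [j jI|].
    have [/(_ jI) xj _] := ident (m + N0)%N (leq_addl _ _) j.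
    by rewrite addnS !mxE xj subrr.
  apply/colP => i; rewrite tr_incl_mx_mul [RHS]mxE.
  have le : (N0 <= m + N)%N by rewrite addnS leqW ?leq_addl.
  by have [_ stat] := ident _ le (enum_val i); rewrite stat ?enum_valP.
have xbarI : E^T *m (Q *m xbar + r) = 0.
  apply/colP => i; rewrite tr_incl_mx_mul [RHS]mxE -(partial_quad _ _ symQ).
  by have [[_ _ stat _] _ _] := sc; rewrite stat ?enum_valP.
pose d m : 'cV[R]_#|I| := E^T *m (x (m + N)%N - xbar).
have dE m : E *m d m = x (m + N)%N - xbar.
  by apply: incl_mx_restrict; have [] := identN m.
(* Subtract the stationarity of [xbar] from that of the proximal step, both restricted to the free
   coordinates. *)
have rec m : Qmm *m d m.+1 + gamma *: d m.+1 = gamma *: d m.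
  have [_ stat] := identN m.
  have split_stat (a b y z : 'cV[R]_n) : a - b + gamma *: (z - xbar) =
      gamma *: (y - xbar) + (a + r + gamma *: (z - y)) - (b + r).
    by apply/colP => j; rewrite !mxE; ring.
  rewrite QmmE -!mulmxA !dE addSn mulmxBr !scalemxAr -mulmxDr.
  by rewrite (split_stat _ _ (x (m + N)%N)) mulmxBr mulmxDr stat xbarI addr0 subr0.
have dW := prox_orbit_orth _ _ _ symQmm delta0 delta_le shift_ge _ rec.
have {}dW m : orth [set v : 'cV[R]_#|I| | exists2 a, a <= 0 & Qmm *m v = a *: v] (d m).
  (* The limit 0 is written as [dot (E *m v) (xbar - xbar)] to use the convergence of [x]. *)
  apply: dW => v; rewrite -(dot0r (E *m v)) -(subrr xbar).
  rewrite (_ : (fun k => dot v (d k)) =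
    (fun k => dot (E *m v) (x (k + N)%N - xbar))); last first.
    by apply/funext => i; rewrite -dE dot_incl_mx.
  apply: (cvg_dot (fun k => x (k + N)%N - xbar)).
  apply: cvgB; last exact: cvg_cst.
  by rewrite cvg_shiftn.
have contr := prox_contraction _ _ _ symQmm delta0 delta_le shift_ge.
pose m := (k - N)%N; have kE : k = (m + N)%N by rewrite subnK.
have diffE i : x (i + N)%N - x (i + N).+1 = E *m (d i - d i.+1).
  by rewrite mulmxBr !dE -addSn opprB addrA subrK.
(* The increments obey the same linear recursion and stay in the same subspace. *)
have ratediff i : norm2 (d i.+1 - d i.+2) <= rho * norm2 (d i - d i.+1).
  by apply: contr; [exact: orthB | rewrite mulmxBr !scalerBr addrACA -opprD !rec].
have rated i : norm2 (d i.+1) <= rho * norm2 (d i) by exact: contr.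
split.
- by rewrite kE -addSn !diffE !norm2_incl_mx.
- by rewrite kE -addSn -!dE !norm2_incl_mx.
have geom i : norm2 (d i - d i.+1) <= rho ^+ i * norm2 (d 0 - d 1).
  elim: i => [|i IH]; first by rewrite expr0 mul1r.
  by apply: le_trans (ratediff i) _; rewrite exprS -mulrA ler_wpM2l.
have rho1' : 0 < 1 - rho by rewrite subr_gt0.
(* Triangle inequality: [|d_m| <= |d_m - d_(m+1)| + rho |d_m|]. *)
have dm : (1 - rho) * norm2 (d m) <= rho ^+ m * norm2 (d 0 - d 1).
  apply: le_trans (geom m); rewrite mulrBl mul1r lerBlDr.
  apply: (@le_trans _ _ (norm2 (d m - d m.+1) + norm2 (d m.+1))).
    by rewrite -{1}(subrK (d m.+1) (d m)) ler_norm2D.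
  by rewrite lerD2l rated.
(* In the Taylor formula at [xbar] the linear term vanishes: the displacement has only free
   components, where the gradient is 0. *)
have -> : q (x k) - q xbar = 2^-1 * dot (d m) (Qmm *m d m).
  have -> : x k = xbar + E *m d m by rewrite kE dE addrC subrK.
  rewrite /q quadD // dot_mulmx xbarI dot0l addr0 addrC addKr.
  by rewrite QmmE -!mulmxA (dot_mulmx E^T) trmxK.
have := diffE 0; rewrite add0n => ->; rewrite norm2_incl_mx -/m.
apply: (@le_trans _ _ (2^-1 * (opnorm2 Qmm * norm2 (d m) ^+ 2))).
  by rewrite ler_pM2l ?invr_gt0 // dot_mulmx_le_opnorm2.
have sqdm := lerXn2r 2 _ _ dm.
have {}sqdm : (1 - rho) ^+ 2 * norm2 (d m) ^+ 2 <=
    rho ^+ (2 * m) * norm2 (d 0 - d 1) ^+ 2.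
  rewrite mulnC exprM -!exprMn; apply: sqdm; rewrite nnegrE mulr_ge0 ?norm2_ge0 //.
    exact: ltW.
  exact: exprn_ge0.
have rho2 : 0 < (1 - rho) ^+ 2 by rewrite exprn_gt0.
rewrite invfM; set D := norm2 (d 0 - d 1) ^+ 2 in sqdm *.
rewrite (_ : _ * D = 2^-1 * (opnorm2 Qmm * (rho ^+ (2 * m) * D / (1 - rho) ^+ 2))).
  rewrite ler_pM2l ?invr_gt0 // ler_wpM2l ?opnorm2_ge0 //.
  by rewrite ler_pdivlMr // mulrC.
by ring.
Qed.
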